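(* Let $\mathrm{Dis}_X$ be a linear disparity measure for classifiers $f_X:\mathcal X\to[0,1]$ not using $A$, with weighting function $w_{X,\mathrm{Dis}}$. Suppose that both $\eta^Y(X)$ and $w_{X,\mathrm{Dis}}(X)$ have probability density functions, the boundary sets $\{x:\eta^Y(x)=\frac12+\frac t2w_{X,\mathrm{Dis}}(x)\}$, $t\in\mathbb R$, being of $\mathbb P_X$-measure zero. Let, for $t\in\mathbb R$, $$D_{X,\mathrm{Dis}}(t)=\int_{\mathcal X}w_{X,\mathrm{Dis}}(x)\,I\Big(\eta^Y(x)>\tfrac12+\tfrac t2w_{X,\mathrm{Dis}}(x)\Big)d\mathbb P_X(x),$$ and for $\delta\ge0$ let $t_{X,\mathrm{Dis}}(\delta)=\operatorname{argmin}_t\{|t|:|D_{X,\mathrm{Dis}}(t)|\le\delta\}$. Then, for any $\delta\ge0$, there exists a $\delta$-fair Bayes-optimal classifier $f^\star_{X,\mathrm{Dis},\delta}$ taking the form, for all $x\in\mathcal X$, $$f^\star_{X,\mathrm{Dis},\delta}(x)=I\Big(\eta^Y(x)>\tfrac12+\tfrac{t_{X,\mathrm{Dis}}(\delta)}2\,w_{X,\mathrm{Dis}}(x)\Big).$$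
   Context: Let $(X,A,Y)\sim\mathbb P$ be a random triple with values in $\mathcal X\times\{0,1\}\times\{0,1\}$, $\eta^Y(x)=\mathbb P(Y=1\mid X=x)$, and $\mathbb P_X$ the law of $X$. $I(\cdot)$ is the indicator function. When the protected attribute is not available for prediction, a classifier is a measurable $f_X:\mathcal X\to[0,1]$ with prediction $\widehat Y_{f_X}\mid X\sim\mathrm{Bernoulli}(f_X(X))$, conditionally independent of $(A,Y)$ given $X$; its misclassification error is $R(f_X)=\mathbb P(Y\ne\widehat Y_{f_X})$. A disparity measure $\mathrm{Dis}_X$ of such classifiers is linear if there is $w_{X,\mathrm{Dis}}:\mathcal X\to\mathbb R$ such that for all $f_X$, $\mathrm{Dis}_X(f_X)=\int_{\mathcal X}f_X(x)\,w_{X,\mathrm{Dis}}(x)\,d\mathbb P_X(x)$. A $\delta$-fair Bayes-optimal classifier is any element of $\operatorname{argmin}_{f_X:\mathcal X\to[0,1]}\{R(f_X):|\mathrm{Dis}_X(f_X)|\le\delta\}$.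
   Formalization: For δ=0 it is additionally assumed that some real t has D(t)=0; otherwise t(0) is undefined and the claim fails (e.g. w(X) uniform on (0,1), η(X) independent and uniform on (0.6,1), where D(t)>0 for all t). *)

(* Defs.v *)
From HB Require Import structures.
From mathcomp Require Import all_boot all_order all_algebra.
From mathcomp Require Import all_classical all_reals all_analysis.
Set Implicit Arguments.
Unset Strict Implicit.
Unset Printing Implicit Defensive.
Import Order.TTheory GRing.Theory Num.Theory.
Import numFieldNormedType.Exports.
Local Open Scope classical_set_scope.
Local Open Scope ring_scope.

Definition argmin (d : Order.disp_t) (V : porderType d) (I : Type)
    (S : set I) (F : I -> V) : set I :=
  [set x | S x /\ forall y, S y -> (F x <= F y)%O].

(* A point of T * bool * bool is a value (x, a, y) of the triple (X, A, Y). *)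
Section triple.
Context (d : measure_display) (T : measurableType d).

Definition featX (z : T * bool * bool) : T := z.1.1.
Definition labelY (z : T * bool * bool) : bool := z.2.

Lemma measurable_featX : measurable_fun [set: T * bool * bool] featX.
Proof. by apply: measurableT_comp; apply: measurable_fst. Qed.

HB.instance Definition _ :=
  isMeasurableFun.Build _ _ _ _ featX measurable_featX.

End triple.

Section fair_classification.
Context (d : measure_display) (T : measurableType d) (R : realType).
Variable P : probability (T * bool * bool)%type R.

Definition lawX : probability T R := distribution P (@featX d T).

(* eta is a version of x |-> P(Y = 1 | X = x); such versions are only
   determined up to a lawX-null set. *)
Definition is_etaY (eta : T -> R) : Prop :=
  lawX.-integrable [set: T] (EFin \o eta) /\
  forall B : set T, measurable B ->
    (\int[lawX]_(x in B) (eta x)%:E)%E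
    = P (@featX d T @^-1` B `&` [set z | labelY z = true]).

Definition has_pdf (h : T -> R) : Prop :=
  measurable_fun [set: T] h /\
  exists g : R -> R,
    [/\ measurable_fun [set: R] g, (forall y, 0 <= g y) &
        forall B : set R, measurable B ->
          lawX (h @^-1` B) = (\int[lebesgue_measure]_(y in B) (g y)%:E)%E].

Record classifier := Classifier {
  classifier_fun :> T -> R ;
  classifier_measurable : measurable_fun [set: T] classifier_fun ;
  classifier_bounds : forall x, 0 <= classifier_fun x <= 1 }.

(* Joint law of ((X, A, Y), Yhat): given (X, A, Y), Yhat is Bernoulli (f X);
   the conditional law depends on X only, which encodes the conditional
   independence of Yhat and (A, Y) given X. *)
Definition prediction_law (f : classifier)
    (C : set ((T * bool * bool) * bool)) : \bar R :=
  (\int[P]_z bernoulli_prob (f (featX z)) (xsection C z))%E.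

Definition misclassification (f : classifier) : \bar R :=
  prediction_law f [set u | labelY u.1 != u.2].

(* Integrability of w is what makes the integral meaningful for every f,
   the constant classifier 1 included. *)
Definition linear_disparity (Dis : classifier -> R) (w : T -> R) : Prop :=
  lawX.-integrable [set: T] (EFin \o w) /\
  forall f : classifier, Dis f = \int[lawX]_x (f x * w x).

Definition fair_bayes_optimal (Dis : classifier -> R) (delta : R) :
    set classifier :=
  argmin [set f | `|Dis f| <= delta] misclassification.

Definition threshold_rule (eta w : T -> R) (t : R) (x : T) : R :=
  (2^-1 + t / 2 * w x < eta x)%R%:R.

Definition DX (eta w : T -> R) (t : R) : R :=
  \int[lawX]_x (w x * threshold_rule eta w t x).

End fair_classification.

(* Main.v *)
(** Duality.  The map [t |-> w x * I(eta x > 1/2 + t/2 w x)] is nonincreasing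
    for each [x], so [D] is nonincreasing; it is continuous by dominated
    convergence, the boundary sets being null, and it tends to
    [\int min(w, 0) <= 0] at [+oo] and to [\int max(w, 0) >= 0] at [-oo].  Hence
    [{t : |D t| <= delta}] is a closed interval with a unique element [t] of least
    modulus, and complementary slackness holds: [D t = delta] if [t > 0] and
    [D t = - delta] if [t < 0].  The misclassification error of [f] is
    [\int (f + eta (1 - 2 f))], so the threshold rule at [t] minimizes the
    Lagrangian [error + t * disparity] pointwise, and slackness turns this into
    optimality among the [delta]-fair classifiers. *)

From HB Require Import structures.
Require Import Defs.
From mathcomp Require Import all_boot all_order all_algebra.
From mathcomp Require Import all_classical all_reals all_analysis.
From mathcomp Require Import measurable_realfun.
From mathcomp Require Import ring lra.
Import Order.TTheory GRing.Theory Num.Theory.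
Import numFieldNormedType.Exports.
Local Open Scope classical_set_scope.
Local Open Scope ring_scope.

(** * Integration against finite and restricted measures *)

Lemma integrable_bounded {d} {T : measurableType d} {R : realType}
    (mu : {finite_measure set T -> \bar R}) (h : T -> R) (M : R) :
    measurable_fun [set: T] h -> (forall x, `|h x| <= M) ->
  mu.-integrable [set: T] (EFin \o h).
Proof.
move=> mh hM; apply: measurable_bounded_integrable => //.
  by rewrite -ge0_fin_numE// fin_num_measure.
exists M; split; first exact: num_real.
by move=> y /ltW My x _ /=; exact: le_trans (hM x) My.
Qed.

(** The complement of [D] is null for the restricted measure, and the two measures agree on
    measurable subsets of [D]. *)
Lemma integral_mrestr {d} {T : measurableType d} {R : realType}
    (mu : {measure set T -> \bar R}) (D : set T) (mD : measurable D)
    (f : T -> \bar R) :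
  (mrestr mu mD).-integrable [set: T] f ->
  (\int[mrestr mu mD]_x f x = \int[mu]_(x in D) f x)%E.
Proof.
move=> intf; rewrite [LHS](negligible_integral (measurableC mD))//; last first.
  by transitivity (mu (~` D `&` D)) => //; rewrite setICl measure0.
rewrite setTD setCK; apply: eq_measure_integral => A mA AD.
by transitivity (mu (A `&` D)) => //; rewrite setIidl.
Qed.

(** * The regression function as a density *)

Section regression_function.
Context {d : measure_display} {T : measurableType d} {R : realType}.
Variable P : probability (T * bool * bool)%type R.

Let D := [set z : T * bool * bool | labelY z = true].

Lemma measurable_labelY : measurable D.
Proof.
have := @measurable_snd _ _ (T * bool)%type bool measurableT [set true].
by rewrite setTI; apply.
Qed.

(** The finite measure B |-> P(X in B, Y = 1), whose density with respect to [lawX] is [eta].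
    Building it as a pushforward of a restriction supplies its measure structure. *)
Definition labelled_law : set T -> \bar R :=
  pushforward (mrestr P measurable_labelY) (@featX d T).

HB.instance Definition _ := Measure.copy labelled_law
  (measure_function_pushforward__canonical__measure_function_Measure
     (mrestr P measurable_labelY) (@measurable_featX d T)).

Let labelled_law_fin : fin_num_fun labelled_law.
Proof.
move=> A mA; apply: fin_num_measure.
by rewrite -[X in measurable X]setTI; exact: measurable_featX.
Qed.

HB.instance Definition _ :=
  @Measure_isFinite.Build _ _ _ labelled_law labelled_law_fin.

(** Extends the defining property of [eta] from indicators to bounded functions of X: [eta] agrees
    almost everywhere with the Radon-Nikodym derivative of [labelled_law], to which the change of
    variables applies. *)
Lemma integral_is_etaY (eta h : T -> R) (M : R) : is_etaY P eta ->
    measurable_fun [set: T] h -> (forall x, `|h x| <= M) ->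
  (\int[P]_(z in D) (h (featX z))%:E = \int[lawX P]_x (h x * eta x)%:E)%E.
Proof.
move=> [int_eta etaP] mh hM.
have etaE B : measurable B ->
    labelled_law B = (\int[lawX P]_(x in B) (eta x)%:E)%E.
  by move=> mB; rewrite etaP.
have dom : labelled_law `<< lawX P.
  apply/null_content_dominatesP => B mB B0; rewrite etaE// null_set_integral//.
  by have := measurable_int _ int_eta; exact: measurable_funS.
have int_h : labelled_law.-integrable [set: T] (EFin \o h).
  exact: integrable_bounded mh hM.
have meta : measurable_fun [set: T] eta.
  by apply/measurable_EFinP; exact: measurable_int int_eta.
have int_hX : (mrestr P measurable_labelY).-integrable setT
    ((EFin \o h) \o @featX d T).
  apply: (integrable_bounded _ (h \o @featX d T) M) => [|z]; last exact: hM.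
  exact: measurableT_comp mh (@measurable_featX d T).
transitivity (\int[labelled_law]_x (h x)%:E)%E.
  rewrite [RHS](integral_pushforward (@measurable_featX d T))//=; last first.
    exact/measurable_EFinP.
  by rewrite integral_mrestr.
rewrite -(Radon_Nikodym_change_of_variables dom measurableT int_h).
rewrite (_ : (fun x => (h x * eta x)%:E) = (EFin \o h) \* (EFin \o eta))%E//.
apply: ae_eq_integral => //.
- apply: emeasurable_funM; first exact/measurable_EFinP.
  by apply: measurable_int; exact: Radon_Nikodym_integrable.
- by apply: emeasurable_funM; exact/measurable_EFinP.
(* The derivative and [eta] have the same integral over every measurable set, hence agree almost
   everywhere. *)
apply: ae_eqe_mul2l; apply: integral_ae_eq => //.
- exact: Radon_Nikodym_integrable.
- exact/measurable_EFinP.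
by move=> E _ mE; rewrite -Radon_Nikodym_integral// -etaE.
Qed.

End regression_function.

(** * Least-modulus solutions of a monotone constraint *)

(** Compactness gives a minimizer, monotonicity its uniqueness, and the intermediate value theorem
    the last two implications, which serve as complementary slackness when [F] is [DX]. *)
Lemma argmin_normr_nonincreasing (R : realType) (F : R -> R) (delta : R) :
    continuous F -> {homo F : x y / x <= y >-> y <= x} ->
    (exists t, `|F t| <= delta) ->
  exists2 t, argmin [set t | `|F t| <= delta] (fun t => `|t|) = [set t] &
    [/\ `|F t| <= delta, 0 < t -> F t = delta & t < 0 -> F t = - delta].
Proof.
move=> cF homoF [t0 Ft0]; pose S := [set t | `|F t| <= delta].
have cnF : continuous (fun t => `|F t|).
  move=> t; apply: (@continuous_comp _ _ _ F Num.norm); first exact: cF.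
  exact: norm_continuous.
have closedS : closed S.
  apply: (@closed_comp _ _ (fun t => `|F t|) [set r | r <= delta]).
    by move=> t _; exact: cnF.
  exact: closed_le.
(* A feasible [t0] confines the search to a compact interval, since points outside it have larger
   modulus. *)
have [t] : exists2 t, t \in `[- `|t0|, `|t0|] `&` S &
    forall s, s \in `[- `|t0|, `|t0|] `&` S -> `|t| <= `|s|.
  apply: compact_EVT_min.
  - by exists t0; split => //=; rewrite in_itv/= -ler_norml.
  - by apply: compact_closedI => //; exact: segment_compact.
  - by apply: continuous_subspaceT; exact: norm_continuous.
rewrite inE => -[]; rewrite /= in_itv/= -ler_norml => tt0 St mint.
have {mint} mint s : S s -> `|t| <= `|s|.
  move=> Ss; have [st0|/ltW] := leP `|s| `|t0|; last exact: le_trans.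
  by apply: mint; rewrite inE; split => //=; rewrite in_itv/= -ler_norml.
(* [F 0] lies between [F t] and [F (- t)]: if both are admissible, so is 0, and minimality gives t =
   0. This rules out [- t] as a second minimizer. *)
have F0 : `|F t| <= delta -> `|F (- t)| <= delta -> t = 0.
  move=> Fp Fn; apply/normr0_eq0/le_anti/andP; split => //.
  rewrite -[X in _ <= X](@normr0 _ R); apply: mint => /=; rewrite /S/= ler_norml.
  move: Fp Fn; rewrite !ler_norml => /andP[p1 p2] /andP[n1 n2].
  have [t_ge0|/ltW t_le0] := leP 0 t.
  - rewrite (le_trans p1 (homoF _ _ t_ge0)).
    by rewrite (le_trans (homoF (- t) 0 _) n2)// oppr_le0.
  - rewrite (le_trans n1 (homoF 0 (- t) _)) ?oppr_ge0//.
    by rewrite (le_trans (homoF _ _ t_le0) p2).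
have noS0 : t != 0 -> ~ S 0.
  by move=> t0'; move/mint; rewrite normr0 normr_le0; apply/negP.
exists t.
  apply/seteqP; split => [s [/= Ss mins]|_ ->]; last by split.
  have /eqP : `|s| = `|t| by apply/le_anti; rewrite mins//= mint.
  rewrite eqr_norm2 => /orP[/eqP//|/eqP st]; move: Ss; rewrite st /= => Fn.
  by rewrite F0// oppr0.
split => [|tlt|tlt]; first exact: St.
(* As 0 is infeasible and [F t <= F 0], necessarily [F 0 > delta]. If [F t < delta], then [F] takes
   the value [delta] at some s in [0, t]; minimality forces s = t, a contradiction. *)
- have /negP : ~ S 0 by apply: noS0; rewrite gt_eqF.
  have := homoF _ _ (ltW tlt); move: St.
  rewrite /S/= !ler_norml => /andP[p1 p2] Ft.
  rewrite (le_trans p1 Ft)/= -ltNge => F0d; apply/le_anti.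
  rewrite p2 leNgt /=; apply/negP => Fd.
  have mid : Num.min (F 0) (F t) <= delta <= Num.max (F 0) (F t).
    by rewrite ge_min le_max p2 (ltW F0d) orbT.
  have [s] := IVT (ltW tlt) (continuous_subspaceT cF) mid.
  rewrite in_itv/= => /andP[s0 st] Fs.
  have : S s by rewrite /S/= Fs ger0_norm// (le_trans (normr_ge0 _) Ft0).
  move=> /mint; rewrite !ger0_norm ?(ltW tlt)// => ts.
  by move: Fs; rewrite (@le_anti _ _ s t) ?st ?ts// => Fs; rewrite Fs ltxx in Fd.
(* Mirror case: [F 0 < - delta], and the value [- delta] is sought on [t, 0]. *)
- have /negP : ~ S 0 by apply: noS0; rewrite lt_eqF.
  have := homoF _ _ (ltW tlt); move: St.
  rewrite /S/= !ler_norml => /andP[p1 p2] Ft.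
  rewrite (le_trans Ft p2) andbT -ltNge => F0d; apply/le_anti.
  rewrite p1 leNgt andbT; apply/negP => Fd.
  have mid : Num.min (F t) (F 0) <= - delta <= Num.max (F t) (F 0).
    by rewrite ge_min le_max p1 (ltW F0d) orbT.
  have [s] := IVT (ltW tlt) (continuous_subspaceT cF) mid.
  rewrite in_itv/= => /andP[ts s0] Fs.
  have : S s by rewrite /S/= Fs normrN ger0_norm// (le_trans (normr_ge0 _) Ft0).
  move=> /mint; rewrite !ler0_norm ?(ltW tlt)// lerN2 => st.
  by move: Fs; rewrite (@le_anti _ _ s t) ?st ?ts// => Fs; rewrite Fs ltxx in Fd.
Qed.

(** * Measurability and monotonicity of threshold rules *)

Lemma integrable_mul_bounded {d} {T : measurableType d} {R : realType}
    (mu : {measure set T -> \bar R}) (g h : T -> R) (M : R) :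
    mu.-integrable [set: T] (EFin \o g) ->
    measurable_fun [set: T] h -> (forall x, `|h x| <= M) ->
  mu.-integrable [set: T] (EFin \o (fun x => g x * h x)).
Proof.
move=> intg mh hM.
rewrite (_ : EFin \o _ = (EFin \o g) \* (EFin \o h))%E//.
apply: integrableMl => //; exists M; split; first exact: num_real.
by move=> y /ltW My x _ /=; exact: le_trans (hM x) My.
Qed.

Section threshold_rule.
Context {d : measure_display} {T : measurableType d} {R : realType}.
Implicit Types eta w : T -> R.

Lemma measurable_threshold_rule eta w t :
  measurable_fun [set: T] eta -> measurable_fun [set: T] w ->
  measurable_fun [set: T] (threshold_rule eta w t).
Proof.
move=> meta mw.
rewrite (_ : threshold_rule eta w t =
    fun x => if 2^-1 + t / 2 * w x < eta x then 1 else 0); last first.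
  by apply/funext => x; rewrite /threshold_rule; case: ifP.
apply: measurable_fun_ifT => //; apply: measurable_fun_ltr => //.
by apply: measurable_funD => //; exact: measurable_funM.
Qed.

Lemma threshold_rule_bounds eta w t x : 0 <= threshold_rule eta w t x <= 1.
Proof. by rewrite /threshold_rule; case: (_ < _); rewrite lexx ler01. Qed.

Lemma normr_threshold_rule_le1 eta w t x : `|threshold_rule eta w t x| <= 1.
Proof.
by case/andP: (threshold_rule_bounds eta w t x) => ? ?; rewrite ger0_norm.
Qed.

(** Raising t raises the threshold where w >= 0, so the indicator can only drop; where w < 0 the
    indicator can only grow, but its weight is negative. *)
Lemma threshold_rule_nonincreasing eta w x :
  {homo (fun t => w x * threshold_rule eta w t x) : s t / s <= t >-> t <= s}.
Proof.
move=> s t st /=; rewrite /threshold_rule.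
have [w0|w0] := leP 0 (w x).
  apply: ler_wpM2l => //; rewrite ler_nat.
  case: (ltP _ (eta x)) => // ht; rewrite (le_lt_trans _ ht)// lerD2l.
  by rewrite ler_wpM2r// ler_wpM2r// invr_ge0.
apply: ler_wnM2l; first exact: ltW.
rewrite ler_nat; case: (ltP _ (eta x)) => // hs; rewrite (le_lt_trans _ hs)//.
by rewrite lerD2l ler_wnM2r ?(ltW w0)// ler_wpM2r// invr_ge0.
Qed.

End threshold_rule.

(** * The disparity of threshold rules as a function of t *)

Section disparity.
Context {d : measure_display} {T : measurableType d} {R : realType}.
Variables (P : probability (T * bool * bool)%type R) (eta : T -> R).
Hypothesis meta : measurable_fun [set: T] eta.
Implicit Type w : T -> R.

Lemma integrable_threshold_rule w t :
  (lawX P).-integrable [set: T] (EFin \o w) ->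
  (lawX P).-integrable [set: T]
    (EFin \o (fun x => w x * threshold_rule eta w t x)).
Proof.
move=> intw; apply: (integrable_mul_bounded _ _ _ 1) => //.
- apply: measurable_threshold_rule => //.
  by apply/measurable_EFinP; exact: measurable_int intw.
- exact: normr_threshold_rule_le1.
Qed.

Lemma DX_nonincreasing w : (lawX P).-integrable [set: T] (EFin \o w) ->
  {homo DX P eta w : s t / s <= t >-> t <= s}.
Proof.
move=> intw s t st; apply: le_Rintegral => //; try exact: integrable_threshold_rule.
by move=> x _; exact: threshold_rule_nonincreasing.
Qed.

(** Dominated convergence with bound |w|. The limit [g] is left free so as to cover both finite t
    and t tending to infinity. *)
Lemma cvg_DX w (u : R^nat) (g : T -> R) :
    (lawX P).-integrable [set: T] (EFin \o w) ->
    measurable_fun [set: T] g ->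
    {ae lawX P, forall x,
      w x * threshold_rule eta w (u n) x @[n --> \oo] --> g x} ->
  DX P eta w (u n) @[n --> \oo] --> \int[lawX P]_x g x.
Proof.
move=> intw mg ug.
pose F n := EFin \o (fun x => w x * threshold_rule eta w (u n) x).
have mF n : measurable_fun [set: T] (F n).
  by have /measurable_int := integrable_threshold_rule w (u n) intw.
have Fg : {ae lawX P, forall x, [set: T] x -> F ^~ x @ \oo --> (EFin \o g) x}.
  by apply: filterS ug => x ux _; apply: cvg_EFin => //; exact: nearW.
have Fw : {ae lawX P, forall x n, [set: T] x -> (`|F n x| <= `|(w x)%:E|)%E}.
  apply: aeW => x n _ /=.
  by rewrite lee_fin normrM ler_piMr// normr_threshold_rule_le1.
have mg' : measurable_fun [set: T] (EFin \o g) by exact/measurable_EFinP.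
have [intg _ cvg] := dominated_convergence measurableT mF mg' Fg
  (integrable_abse intw) Fw.
apply: fine_cvg; rewrite fineK//.
exact: integrable_fin_num.
Qed.

Lemma DX_continuous w : (lawX P).-integrable [set: T] (EFin \o w) ->
    (forall t, lawX P [set x | eta x = 2^-1 + t / 2 * w x] = 0%E) ->
  continuous (DX P eta w).
Proof.
(* Dominated convergence concerns sequences, so continuity is reduced to sequential one-sided
   limits. *)
move=> intw bd t; suff cvgu (u : R^nat) : u n @[n --> \oo] --> t ->
    DX P eta w (u n) @[n --> \oo] --> DX P eta w t.
  apply/left_right_continuousP; split.
    by apply/cvg_at_leftP => u [_]; exact: cvgu.
  by apply/cvg_at_rightP => u [_]; exact: cvgu.
move=> ut.
have mw : measurable_fun [set: T] w.
  by apply/measurable_EFinP; exact: measurable_int intw.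
apply: cvg_DX => //.
  by apply: measurable_funM => //; exact: measurable_threshold_rule.
exists [set x | eta x = 2^-1 + t / 2 * w x]; split.
- rewrite (_ : [set x | _] =
      (fun x => eta x - (2^-1 + t / 2 * w x)) @^-1` [set 0]); last first.
    apply/seteqP; split => x /= /eqP.
      by rewrite -subr_eq0 => /eqP.
    by rewrite subr_eq0 => /eqP.
  rewrite -[X in measurable X]setTI; apply: (_ : measurable_fun _ _) => //.
  apply: measurable_funB => //; apply: measurable_funD => //.
  exact: measurable_funM.
- exact: bd.
move=> x /=; apply: contra_notP => /eqP etax.
have cu : 2^-1 + u n / 2 * w x @[n --> \oo] --> 2^-1 + t / 2 * w x.
  apply: cvgD; first exact: cvg_cst.
  by apply: cvgMl; apply: cvgMl.
apply: cvgM; first exact: cvg_cst.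
(* Off the boundary set the inequality at t is strict, so it persists along [u] and the indicator is
   eventually constant. *)
apply: cvg_near_cst; move: etax; rewrite /threshold_rule neq_lt => /orP[lt|lt].
- near=> n; congr (nat_of_bool _)%:R.
  rewrite [RHS]ltNge (ltW lt) /=; apply/negbTE; rewrite -leNgt ltW//.
  by near: n; exact: cvgr_gt lt.
- near=> n; congr (nat_of_bool _)%:R; rewrite [RHS]lt.
  by near: n; exact: cvgr_lt lt.
Unshelve. all: by end_near.
Qed.

Lemma DX_le_pos w (delta : R) : (lawX P).-integrable [set: T] (EFin \o w) ->
  0 < delta -> exists t, DX P eta w t <= delta.
Proof.
move=> intw delta0.
have mw : measurable_fun [set: T] w.
  by apply/measurable_EFinP; exact: measurable_int intw.
have : DX P eta w n%:R @[n --> \oo] --> \int[lawX P]_x Num.min (w x) 0.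
  apply: cvg_DX => //; first exact: measurable_minr.
  apply: aeW => x; apply: cvg_near_cst.
  (* For w x > 0 the threshold eventually exceeds [eta x] and the product is 0; for w x < 0 it
     eventually drops below and the product is [w x]. *)
  have [w0|w0|->] := ltgtP (w x) 0; last first.
  - by near=> n; rewrite mul0r.
  - near=> n; suff h : eta x <= 2^-1 + n%:R / 2 * w x.
      by rewrite /threshold_rule ltNge h mulr0.
    rewrite -lerBlDl -ler_pdivrMr// ler_pdivlMr//.
    by near: n; exact: nbhs_infty_ger.
  - near=> n; suff h : 2^-1 + n%:R / 2 * w x < eta x.
      by rewrite /threshold_rule h mulr1.
    rewrite -ltrBrDl -ltr_ndivrMr// ltr_pdivlMr//.
    by near: n; exact: nbhs_infty_gtr.
move=> /cvgr_lt /(_ delta) []; last first.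
  by move=> n _ /(_ n (leqnn n)) /ltW ?; exists n%:R.
rewrite (le_lt_trans _ delta0)//.
rewrite -[leRHS](mul0r (fine (lawX P setT))) -Rintegral_cst//.
apply: le_Rintegral => //.
- apply: le_integrable intw => //.
    by apply/measurable_EFinP; exact: measurable_minr.
  move=> x _ /=; rewrite lee_fin; have [//|_] := leP (w x) 0.
  by rewrite normr0.
- exact: finite_measure_integrable_cst.
- by move=> x _; rewrite ge_min lexx orbT.
Unshelve. all: by end_near.
Qed.

(** This symmetry turns the upper bound of [DX_le_pos] into a lower bound. *)
Lemma DXN w t : (lawX P).-integrable [set: T] (EFin \o w) ->
  DX P eta (\- w) t = - DX P eta w (- t).
Proof.
move=> intw; rewrite /DX -mulN1r -RintegralZl//; last first.
  exact: integrable_threshold_rule.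
apply: eq_Rintegral => x _.
by rewrite mulN1r -mulNr /threshold_rule /= mulrN !mulNr.
Qed.

Lemma DX_small w (delta : R) : (lawX P).-integrable [set: T] (EFin \o w) ->
    (forall t, lawX P [set x | eta x = 2^-1 + t / 2 * w x] = 0%E) ->
  0 < delta -> exists t, `|DX P eta w t| <= delta.
Proof.
move=> intw bd delta0; have [t tP] := DX_le_pos _ _ intw delta0.
have intNw : (lawX P).-integrable [set: T] (EFin \o (\- w)).
  exact: integrableN intw.
have [s] := DX_le_pos _ _ intNw delta0; rewrite DXN// lerNl => sP.
(* Either t or [- s] is already feasible, or [DX] is above [delta] at [- s] and below [- delta] at
   t, hence vanishes in between. *)
have [Dt|Dt] := leP (- delta) (DX P eta w t).
  by exists t; rewrite ler_norml Dt tP.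
have [Ds|Ds] := leP (DX P eta w (- s)) delta.
  by exists (- s); rewrite ler_norml Ds sP.
have st : - s <= t.
  rewrite leNgt; apply/negP => /ltW /(DX_nonincreasing _ intw).
  by rewrite leNgt (lt_trans Dt)// (lt_trans _ Ds)// gtrN.
have mid : Num.min (DX P eta w (- s)) (DX P eta w t) <= 0 <=
    Num.max (DX P eta w (- s)) (DX P eta w t).
  rewrite ge_min le_max (ltW (lt_trans delta0 Ds))/= andbT.
  by rewrite (ltW (lt_trans Dt _)) ?oppr_lt0// orbT.
have [r _ r0] := IVT st (continuous_subspaceT (DX_continuous _ intw bd)) mid.
by exists r; rewrite r0 normr0 ltW.
Qed.

End disparity.

(** * The misclassification error as an integral over X *)

Lemma classifier_normr_le1 {d} {T : measurableType d} {R : realType}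
  (f : classifier T R) x : `|f x| <= 1.
Proof. by case/andP: (classifier_bounds f x) => ? ?; rewrite ger0_norm. Qed.

Lemma misclassificationE {d} {T : measurableType d} {R : realType}
    (P : probability (T * bool * bool)%type R) (eta : T -> R)
    (f : classifier T R) : is_etaY P eta ->
  misclassification P f = (\int[lawX P]_x (f x + eta x * (1 - 2 * f x)))%:E.
Proof.
move=> etaP; have [int_eta _] := etaP; have mf := classifier_measurable f.
pose h x := 1 - 2 * f x.
have mh : measurable_fun [set: T] h.
  by apply: measurable_funB => //; exact: measurable_funM.
have h1 x : `|h x| <= 1.
  have /andP[? ?] := classifier_bounds f x.
  by rewrite /h ler_norml; apply/andP; split; lra.
have mX := @measurable_featX d T.
have int_f : (lawX P).-integrable [set: T] (EFin \o f).
  exact: (integrable_bounded _ f 1 mf (classifier_normr_le1 f)).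
have int_fX : P.-integrable setT (EFin \o (f \o @featX d T)).
  apply: (integrable_bounded _ (f \o @featX d T) 1) => [|z].
    exact: measurableT_comp mf mX.
  exact: classifier_normr_le1.
have int_hX : P.-integrable setT (EFin \o (h \o @featX d T)).
  apply: (integrable_bounded _ (h \o @featX d T) 1) => [|z].
    exact: measurableT_comp mh mX.
  exact: h1.
have int_eh : (lawX P).-integrable [set: T] (EFin \o (fun x => eta x * h x)).
  exact: integrable_mul_bounded int_eta mh h1.
pose D := [set z : T * bool * bool | labelY z = true].
have mD : measurable D := measurable_labelY.
rewrite /misclassification /prediction_law.
(* Given (X, A, Y), the error probability is f when Y = 0 and 1 - f when Y = 1, that is f + I(Y = 1)
   (1 - 2 f). *)
transitivity (\int[P]_z ((f (featX z))%:E +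
    ((EFin \o (h \o @featX d T)) \_ D) z))%E.
  apply: eq_integral => z _.
  rewrite bernoulli_probE; last exact: classifier_bounds.
  have memC b : (b \in xsection [set u | labelY u.1 != u.2] z) = (labelY z != b).
    by rewrite mem_xsection; apply/idP/idP; rewrite inE.
  have memD : (z \in D) = labelY z by apply/idP/idP; rewrite inE.
  rewrite patchE memD !diracE !memC /unstable.onem -!EFinM -EFinD.
  case: (labelY z) => /=; rewrite ?adde0 -?EFinD; congr EFin; rewrite /h; ring.
rewrite integralD//; last first.
  by rewrite -integrable_mkcond//; exact: integrableS int_hX.
rewrite -integral_mkcond (integral_is_etaY _ _ _ 1 etaP mh h1).
rewrite -(@integral_distribution _ _ _ _ _ P (@featX d T) (EFin \o f))//; last first.
  exact/measurable_EFinP.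
under [X in (_ + X)%E]eq_integral do rewrite mulrC.
rewrite -integralD_EFin// fineK//.
apply: integrable_fin_num => //.
exact: (integrableD measurableT int_f int_eh).
Qed.

(** * Optimality by Lagrangian duality *)

Theorem corollary4p8 (d : measure_display) (T : measurableType d)
    (R : realType) (P : probability (T * bool * bool)%type R)
    (eta w : T -> R) (Dis : classifier T R -> R)
    (eta_version : is_etaY P eta)
    (Dis_linear : linear_disparity P Dis w)
    (eta_pdf : has_pdf P eta) (w_pdf : has_pdf P w)
    (boundary0 : forall t : R,
       lawX P [set x | eta x = 2^-1 + t / 2 * w x] = 0%E)
    (delta : R) (delta_ge0 : 0 <= delta)
    (t_welldef : delta = 0 -> exists t : R, DX P eta w t = 0) :
  exists2 tX : R,
    argmin [set t : R | `|DX P eta w t| <= delta] (fun t : R => `|t|)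
      = [set tX] &
    exists2 f : classifier T R, fair_bayes_optimal P Dis delta f &
      forall x : T, f x = threshold_rule eta w tX x.
Proof.
have [meta _] := eta_pdf; have [mw _] := w_pdf.
have [intw DisE] := Dis_linear; have [inteta _] := eta_version.
have [t tS [Dt t_gt0 t_lt0]] : exists2 t,
    argmin [set t | `|DX P eta w t| <= delta] (fun t => `|t|) = [set t] &
    [/\ `|DX P eta w t| <= delta, 0 < t -> DX P eta w t = delta &
        t < 0 -> DX P eta w t = - delta].
  apply: argmin_normr_nonincreasing.
  - exact: DX_continuous.
  - exact: DX_nonincreasing.
  (* For [delta = 0] feasibility comes from [t_welldef], since [DX] might approach 0 only at
     infinity. *)
  - move: delta_ge0; rewrite le_eqVlt => /predU1P[/esym delta0|delta_gt0].
      by have [s s0] := t_welldef delta0; exists s; rewrite s0 normr0 delta0.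
    exact: DX_small.
exists t => //.
pose f := Classifier (measurable_threshold_rule eta w t meta mw)
  (threshold_rule_bounds eta w t).
have DisfE (g : classifier T R) : Dis g = \int[lawX P]_x (w x * g x).
  by rewrite DisE; apply: eq_Rintegral => x _; rewrite mulrC.
exists f => //; split => [|g /= Dg]; first by rewrite /= DisfE.
rewrite !(misclassificationE _ _ _ eta_version) lee_fin.
have int_err (k : classifier T R) : (lawX P).-integrable [set: T]
    (EFin \o (fun x => k x + eta x * (1 - 2 * k x))).
  have mk := classifier_measurable k.
  have int_k : (lawX P).-integrable [set: T] (EFin \o k).
    exact: (integrable_bounded _ k 1 mk (classifier_normr_le1 k)).
  have int_ek : (lawX P).-integrable [set: T]
      (EFin \o (fun x => eta x * (1 - 2 * k x))).
    apply: (integrable_mul_bounded _ _ _ 1) => // [|x].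
      by apply: measurable_funB => //; exact: measurable_funM.
    have /andP[? ?] := classifier_bounds k x.
    by rewrite ler_norml; apply/andP; split; lra.
  exact: (integrableD measurableT int_k int_ek).
have int_wk (k : classifier T R) : (lawX P).-integrable [set: T]
    (EFin \o (fun x => w x * k x)).
  exact: integrable_mul_bounded intw (classifier_measurable k)
    (classifier_normr_le1 k).
have int_twk (k : classifier T R) : (lawX P).-integrable [set: T]
    (EFin \o (fun x => t * (w x * k x))).
  exact: (integrableZl measurableT t (int_wk k)).
have lagrangianE (k : classifier T R) :
    \int[lawX P]_x ((k x + eta x * (1 - 2 * k x)) + t * (w x * k x)) =
    \int[lawX P]_x (k x + eta x * (1 - 2 * k x)) + t * Dis k.
  rewrite RintegralD ?DisfE//; congr (_ + _).
  by apply: (RintegralZl _ _ (int_wk k)).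
(* By slackness [t * Dis f] equals |t| [delta], the largest value over feasible classifiers. *)
have tDis : t * Dis g <= t * Dis f.
  rewrite (DisfE f) -/(DX P eta w t); move: Dg; rewrite ler_norml => /andP[gd dg].
  have [t0|t0|->] := ltgtP t 0; last by rewrite !mul0r.
  - by rewrite t_lt0// ler_nM2l.
  - by rewrite t_gt0// ler_pM2l.
(* [f] minimizes the Lagrangian [k + eta (1 - 2 k) + t w k] pointwise. *)
have : \int[lawX P]_x ((f x + eta x * (1 - 2 * f x)) + t * (w x * f x)) <=
       \int[lawX P]_x ((g x + eta x * (1 - 2 * g x)) + t * (w x * g x)).
  apply: le_Rintegral => //.
  - exact: (integrableD measurableT (int_err f) (int_twk f)).
  - exact: (integrableD measurableT (int_err g) (int_twk g)).
  move=> x _; have /andP[g0 g1] := classifier_bounds g x.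
  (* The integrand is eta + k (1 - 2 eta + t w), affine in k, and the threshold rule sets k = 1
     exactly where the slope is negative. *)
  rewrite /f /= /threshold_rule; case: ltP => /= h; nra.
rewrite !lagrangianE; lra.
Qed.
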